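(* Suppose all travel time functions $\tau_{i,p}$ are continuous and all externality functions $g_{i,p,j}$ are constant. Then every feasible budget vector $B$ that is both extremal and Pareto-minimal is strictly implementable: there exists $\lambda\in\mathbb{R}^J_{>0}$ such that $\mathrm{WE}(\lambda)\neq\emptyset$ and every $u\in\mathrm{WE}(\lambda)$ satisfies $G_j(u)\le B_j$ for all $j\in J$.
   Context: Let $G=(V,E)$ be a directed graph and $I$ a finite set of commodities; commodity $i$ has source $s_i$, sink $t_i$ and demand $d_i>0$. $\mathcal P_i$ is the set of simple $s_i$–$t_i$ paths, $\mathcal P=\{(i,p)\}$. A flow $x\in\mathbb{R}^{\mathcal P}_{\ge 0}$ is feasible if $\sum_{p\in\mathcal P_i}x_{i,p}=d_i$ for all $i$; $\mathcal F$ is the set of feasible flows. $J$ is a finite set of externality classes with externality functions $g_{i,p,j}\ge0$ and $G_j(x)=\sum_{(i,p)}g_{i,p,j}(x)x_{i,p}$. Travel times $\tau_{i,p}:\mathcal F\to\mathbb{R}$. For $\lambda\in\mathbb{R}^J_{\ge0}$, $c^\lambda_{i,p}(x)=\tau_{i,p}(x)+\sum_j\lambda_jg_{i,p,j}(x)$; $x\in\mathrm{WE}(\lambda)$ means $x\in\mathcal F$ and $x_{i,p}>0$ implies $c^\lambda_{i,p}(x)\le c^\lambda_{i,q}(x)$ for all $q\in\mathcal P_i$. A budget $B\in\mathbb{R}^J_{\ge0}$ is feasible if some $x\in\mathcal F$ has $G_j(x)\le B_j$ for all $j$; it is Pareto-minimal if no other feasible $B'\ne B$ satisfies $B'_j\le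 B_j$ for all $j$; it is extremal if it is not a convex combination of two distinct feasible budget vectors. *)

(* Defs.v *)
From HB Require Import structures.
From mathcomp Require Import all_boot all_order all_algebra.
From mathcomp Require Import reals.
Import Order.TTheory GRing.Theory Num.Theory.
Set Implicit Arguments.
Unset Strict Implicit.
Unset Printing Implicit Defensive.
Local Open Scope ring_scope.

(* Simple paths in a directed graph (V, E), V finite, E : rel V.       *)
(* A simple path is a duplicate-free vertex sequence; it has at most   *)
(* #|V| vertices, so it is encoded (uniquely) as a pair (n, tuple of   *)
(* length n) with n < #|V|.+1.  This gives a finite type of paths.     *)

Definition code (V : finType) := {n : 'I_#|V|.+1 & n.-tuple V}.

Definition code_seq (V : finType) (c : code V) : seq V := tval (tagged c).

Definition is_spath (V : finType) (E : rel V) (s t : V) (p : seq V) : bool :=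
  if p is a :: r then [&& a == s, path E a r, last a r == t & uniq p]
  else false.

Definition spath (V : finType) (E : rel V) (s t : V) :=
  {c : code V | is_spath E s t (code_seq c)}.

Definition pathset (V : finType) (E : rel V) (I : finType) (s t : I -> V) :=
  {i : I & spath E (s i) (t i)}.

Section Routing.
Variables (R : realType) (V : finType) (E : rel V) (I J : finType)
  (s t : I -> V) (d : I -> R).

Local Notation P := (pathset E s t).

Definition feasible_flow (x : P -> R) : Prop :=
  (forall a, 0 <= x a) /\ (forall i, \sum_(a : P | tag a == i) x a = d i).

(* continuity of a function F -> R, F with the (finite-dim.) product topology *)
Definition continuous_on_F (f : (P -> R) -> R) : Prop :=
  forall x, feasible_flow x -> forall eps : R, 0 < eps ->
    exists2 del : R, 0 < del & forall y, feasible_flow y ->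
      (forall a, `|y a - x a| < del) -> `|f y - f x| < eps.

Variables (tau : P -> (P -> R) -> R) (g : P -> J -> (P -> R) -> R).

Definition Gext (j : J) (x : P -> R) : R := \sum_(a : P) g a j x * x a.

Definition cost (lam : J -> R) (a : P) (x : P -> R) : R :=
  tau a x + \sum_(j : J) lam j * g a j x.

Definition WE (lam : J -> R) (x : P -> R) : Prop :=
  feasible_flow x /\
  forall a b : P, tag a = tag b -> 0 < x a -> cost lam a x <= cost lam b x.

Definition feasible_budget (B : J -> R) : Prop :=
  (forall j, 0 <= B j) /\
  exists x, feasible_flow x /\ forall j, Gext j x <= B j.

Definition pareto_minimal (B : J -> R) : Prop :=
  feasible_budget B /\
  forall B' : J -> R, feasible_budget B' -> (forall j, B' j <= B j) ->
    forall j, B' j = B j.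

Definition extremal (B : J -> R) : Prop :=
  ~ exists (B1 B2 : J -> R) (mu : R),
      [/\ feasible_budget B1, feasible_budget B2, exists j, B1 j <> B2 j,
          0 < mu < 1 &
          forall j, B j = mu * B1 j + (1 - mu) * B2 j].

Definition strictly_implementable (B : J -> R) : Prop :=
  exists lam : J -> R, (forall j, 0 < lam j) /\
    (exists x, WE lam x) /\
    (forall u, WE lam u -> forall j, Gext j u <= B j).

End Routing.

(* Main.v *)
(** With constant externalities, the feasible budgets form the upward closure of
    the convex hull of finitely many vectors [w_k], one for each choice [k] of a
    path per commodity.  An extremal and Pareto-minimal [B] is a vertex of it, so
    by Gordan's theorem a positive [lam] attains its minimum on the [w_k] exactly
    where [w_k = B].  As travel times are bounded on the compact set of flows, for
    [M] large every equilibrium under the prices [M * lam] uses only paths of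
    least [lam]-price in their commodity, hence has externality vector [B].

    Both Gordan's theorem and the existence of an equilibrium follow from one
    statement: continuous costs on a simplex have a point whose support consists
    of coordinates of least cost.  It is obtained without triangulations, from
    Scarf's parity argument for "dominant" subsets of a grid carrying one linear
    order per coordinate, where each grid point is coloured by a coordinate of
    least cost, followed by a passage to the limit. *)
Require Import Defs.
From HB Require Import structures.
From mathcomp Require Import boolp classical_sets filter topology normedtype.
From mathcomp Require Import all_boot all_order all_algebra.
From mathcomp Require Import reals.
From mathcomp Require Import zify lra.
Import Order.TTheory GRing.Theory Num.Theory numFieldNormedType.Exports.
Set Implicit Arguments.
Unset Strict Implicit.
Unset Printing Implicit Defensive.

(** * Scarf's lemma *)

Section Scarf.
Variables (X I : finType) (r : I -> X -> nat).
Hypothesis r_inj : forall i, injective (r i).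

(** Scarf's condition: for nonempty [S], no [y] lies strictly above the minimum of [S] in all orders
    at once. *)
Definition dominant (S : {set X}) : bool :=
  [forall y, exists i, forall z in S, r i y <= r i z].

Lemma dominantP (S : {set X}) :
  reflect (forall y, exists i, forall z, z \in S -> r i y <= r i z) (dominant S).
Proof.
apply: (iffP forallP) => H y.
  by have /existsP[i /forall_inP Hi] := H y; exists i.
by have [i Hi] := H y; apply/existsP; exists i; apply/forall_inP.
Qed.

Lemma dominant_sub (S S' : {set X}) : S' \subset S -> dominant S -> dominant S'.
Proof.
move=> /subsetP sub /dominantP H; apply/dominantP => y.
by have [i Hi] := H y; exists i => z /sub; apply: Hi.
Qed.

Definition extensions (S : {set X}) : {set X} :=
  [set y | (y \notin S) && dominant (y |: S)].

Section Door.
Variables (S : {set X}) (x0 : X).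
Hypotheses (x0S : x0 \in S) (domS : dominant S) (cardS : #|S|.+1 = #|I|).

Let m (l : I) : X := [arg min_(x < x0 in S) r l x].

Let mS l : m l \in S.
Proof. by rewrite /m; case: arg_minnP. Qed.

Let m_min l x : x \in S -> r l (m l) <= r l x.
Proof. by rewrite /m; case: arg_minnP => // z _; apply. Qed.

Let below_min l y : r l y <= r l (m l) -> forall z, z \in S -> r l y <= r l z.
Proof. by move=> h z /(m_min l); apply: leq_trans. Qed.

Let m_onto x : x \in S -> exists l, m l = x.
Proof.
move=> xS; have /dominantP/(_ x)[l Hl] := domS.
by exists l; apply/(r_inj (i := l))/eqP; rewrite eqn_leq m_min //= Hl.
Qed.

Let m_collision : exists i j, i != j /\ m i = m j.
Proof.
have /injectivePn[i [j ij e]] : ~~ injectiveb m.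
  apply/negP => /injectiveP /card_codom e.
  have : #|codom m| <= #|S|.
    by apply/subset_leq_card/subsetP => x /codomP[l ->].
  by rewrite e -cardS ltnn.
by exists i, j.
Qed.

Let above k := [pred y | [forall l, (l != k) ==> (r l (m l) < r l y)]].

Let aboveP k y : reflect (forall l, l != k -> r l (m l) < r l y) (above k y).
Proof.
by apply: (iffP forallP) => H l; [move=> lk; exact: implyP (H l) lk|apply/implyP/H].
Qed.

Let top k w := [arg max_(y > w in above k) r k y].

Let topP k w : above k w ->
  above k (top k w) /\ (forall y, above k y -> r k y <= r k (top k w)).
Proof. by move=> aw; rewrite /top; case: arg_maxnP. Qed.

Let top_low k w : above k w -> r k (top k w) <= r k (m k).
Proof.
move=> /topP[/aboveP atop _]; have /dominantP/(_ (top k w))[l Hl] := domS.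
have [lk|lk] := eqVneq l k; first by subst l; exact: Hl.
by have := atop l lk; rewrite ltnNge Hl.
Qed.

Let top_extends k k' w : k != k' -> m k = m k' -> above k w ->
  top k w \in extensions S.
Proof.
move=> kk' e aw; have [/aboveP atop tmax] := topP aw; have tlow := top_low aw.
rewrite inE; apply/andP; split.
  apply/negP => tS.
  have E : top k w = m k by apply/(r_inj (i := k))/eqP; rewrite eqn_leq tlow m_min.
  by have := atop k'; rewrite eq_sym kk' E e ltnn => /(_ isT).
apply/dominantP => z; have [/tmax zt|nz] := boolP (above k z).
  exists k => y; rewrite !inE => /orP[/eqP-> //|yS].
  by apply: leq_trans zt _; apply: below_min yS.
have [l lk zl] : exists2 l, l != k & r l z <= r l (m l).
  move: nz => /forallPn[l]; rewrite negb_imply -leqNgt => /andP[lk zl].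
  by exists l.
exists l => y; rewrite !inE => /orP[/eqP->|]; last exact: below_min.
exact: leq_trans zl (ltnW (atop l lk)).
Qed.

(** Each member of [S] stays the minimum of [y |: S] in some order, where [y] exceeds it. So [m]
    maps [L] onto [S]; counting leaves [k] as the only order outside [L] and makes [m] injective on
    [L], whence any collision of [m] involves [k]. *)
Let extension_top y : y \in extensions S ->
  exists k, [/\ above k y, forall i j, i != j -> m i = m j -> (k == i) || (k == j) &
                forall w, above k w -> y = top k w].
Proof.
rewrite inE => /andP[yS /dominantP dom].
have [k Hk] := dom y.
pose L := [set l | r l (m l) < r l y].
have kL : k \notin L by rewrite inE -leqNgt Hk // !inE mS orbT.
have mL : S \subset m @: L.
  apply/subsetP => z zS; have [l Hl] := dom z.
  have E : m l = z.
    by apply/(r_inj (i := l))/eqP; rewrite eqn_leq m_min //= Hl // !inE mS orbT.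
  apply/imsetP; exists l => //; rewrite inE E ltn_neqAle Hl ?inE ?eqxx // andbT.
  by apply: contraNneq yS => /r_inj <-.
have cL : #|S| <= #|m @: L| <= #|L| by rewrite subset_leq_card // leq_imset_card.
have LE : L = [set~ k].
  apply/eqP; rewrite eqEcard; apply/andP; split.
    by apply/subsetP => l lL; rewrite !inE; apply: contraNneq kL => <-.
  rewrite cardsC1 -cardS /=; case/andP: cL; exact: leq_trans.
have injL : {in L &, injective m}.
  apply/imset_injP; rewrite eqn_leq leq_imset_card /=.
  case/andP: cL => h _; apply: leq_trans h.
  by rewrite LE cardsC1 -cardS.
have ab : above k y.
  apply/aboveP => l lk; have : l \in L by rewrite LE !inE.
  by rewrite inE.
exists k; split=> //.
  move=> i j ij e; apply/norP => -[ki kj]; move/eqP: ij; apply.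
  by apply: injL; rewrite // LE !inE eq_sym.
move=> w aw; have [/aboveP at1 at2] := topP aw.
apply/(r_inj (i := k))/eqP; rewrite eqn_leq at2 //=.
have [l Hl] := dom (top k w).
have [lk|lk] := eqVneq l k; first by subst l; rewrite Hl // !inE eqxx.
by have := at1 l lk; rewrite ltnNge Hl // !inE mS orbT.
Qed.

(* Two orders [i != j] have the same minimum on [S].  A new element [y] must be
   the minimum for one of them, say [k], and then [y] is the [k]-largest element
   exceeding the minima of all the other orders. *)
Lemma card_extensions :
  (forall k, exists w, forall l, l != k ->
      exists2 z, z \in S & r l z < r l w) ->
  #|extensions S| = 2.
Proof.
move=> Hw.
have ab k : exists w, above k w.
  have [w Hk] := Hw k; exists w; apply/aboveP => l lk.
  have [z zS zw] := Hk l lk; exact: leq_ltn_trans (m_min l zS) zw.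
have [i [j [ij e]]] := m_collision.
have [wi ai] := ab i; have [wj aj] := ab j.
have -> : extensions S = [set top i wi; top j wj].
  apply/setP => y; rewrite in_set2; apply/idP/orP.
    move=> /extension_top[k [_ /(_ i j ij e)/orP[]/eqP-> t]];
      by [left; apply/eqP/t|right; apply/eqP/t].
  case=> /eqP->; first exact: (top_extends ij e ai).
  by apply: (top_extends _ (esym e) aj); rewrite eq_sym.
(* A common value of the two tops would exceed the minimum of [S] in every order, against
   dominance. *)
rewrite cards2; case: eqVneq => //= E; exfalso.
have [/aboveP ti _] := topP ai; have [/aboveP tj _] := topP aj.
have /dominantP/(_ (top i wi))[l Hl] := domS.
have := Hl _ (mS l); rewrite leqNgt; apply/negP; rewrite negbK.
have [li|] := eqVneq l i; last exact: ti.
by rewrite E; apply: tj; rewrite li.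
Qed.

End Door.

Variables (c : X -> I) (slack : I -> X) (x1 : X) (i0 : I).
Hypotheses (slack_low : forall i x, r i (slack i) <= r i x)
  (slack_high : forall i j x, i != j -> x \notin codom slack ->
     r i x < r i (slack j))
  (c_slack : forall j, c (slack j) = j)
  (x1P : x1 \notin codom slack).

Let slack_min i x : r i x <= r i (slack i) -> x = slack i.
Proof. by move=> h; apply/(r_inj (i := i))/eqP; rewrite eqn_leq h slack_low. Qed.

Let outer : {set X} := slack @: [set~ i0].

(** In an order [l] other than [i0], nothing but [slack l] is as low as [slack l], a member of
    [outer]. So dominance at a non-slack element must come from [i0], and the new element is the
    [i0]-largest non-slack one. *)
Let outer_ext : #|extensions outer| = 1.
Proof.
pose P := [predC codom slack].
have xP : P x1 by exact: x1P.
pose y0 := [arg max_(y > x1 in P) r i0 y].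
have [y0P y0max] : y0 \in P /\ forall y, y \in P -> r i0 y <= r i0 y0.
  by rewrite /y0; case: arg_maxnP.
rewrite -(cards1 y0); congr #|pred_of_set _|; apply/setP => y; rewrite !inE.
apply/andP/eqP.
  case=> yo /dominantP dom.
  have low z : z \in P -> r i0 z <= r i0 y.
    move=> zP; have [l Hl] := dom z.
    have [li|li] := eqVneq l i0; first by subst l; apply: Hl; rewrite !inE eqxx.
    have zE : z = slack l.
      by apply: slack_min; apply: Hl; rewrite !inE; apply/orP; right;
      apply: imset_f; rewrite !inE.
    by move: zP; rewrite !inE zE codom_f.
  have yP : y \in P.
    rewrite !inE; apply/negP => /codomP[j yj].
    have ji : j = i0.
      apply/eqP; apply: contraNT yo => ji; rewrite yj; apply: imset_f.
      by rewrite !inE.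
    have x1E : x1 = slack i0 by apply: slack_min; have := low x1 x1P; rewrite yj ji.
    by move: x1P; rewrite x1E codom_f.
  by apply/(r_inj (i := i0))/eqP; rewrite eqn_leq low // y0max.
move=> ->; split.
  apply/negP => /imsetP[j _ e]; by move: y0P; rewrite !inE e codom_f.
apply/dominantP => z; have [/codomP[j ->]|zP] := boolP (z \in codom slack).
  by exists j => *; apply: slack_low.
exists i0 => x; rewrite !inE => /orP[/eqP->|/imsetP[j]]; first exact: y0max.
by rewrite !inE => ji ->; apply/ltnW/slack_high; rewrite // eq_sym.
Qed.

Let good (D : {set X}) := c @: D == [set~ i0].

Let door D := [&& dominant D, #|D|.+1 == #|I| & good D].

Let card_i0 : #|[set~ i0]|.+1 = #|I|.
Proof. by rewrite cardsC1 prednK //; apply/card_gt0P; exists i0. Qed.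

Let slack_inj : injective slack.
Proof. exact: can_inj c_slack. Qed.

Let outer_door : door outer.
Proof.
apply/and3P; split.
- have /card_gt0P[y] : 0 < #|extensions outer| by rewrite outer_ext.
  by rewrite inE => /andP[_]; apply/dominant_sub/subsetUr.
- by rewrite card_imset // card_i0.
- rewrite /good /outer -imset_comp (eq_imset (g := id)) ?imset_id // => j /=.
Qed.

Let door_ext D : door D -> D != outer -> #|extensions D| = 2.
Proof.
move=> /and3P[domD /eqP cardD /eqP gD] Do.
have [x xD xP] : exists2 x, x \in D & x \notin codom slack.
  apply/exists_inP; rewrite -[X in is_true X]negbK negb_exists_in.
  apply: contra Do => /forall_inP h; rewrite eqEcard card_imset //.
  rewrite -ltnS card_i0 cardD leqnn andbT; apply/subsetP => y yD.
  have := h y yD; rewrite negbK => /codomP[j yj]; rewrite yj imset_f //.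
  by rewrite -gD; apply/imsetP; exists y; rewrite // yj c_slack.
(* In every order but [k], [slack k] exceeds the non-slack member [x] of [D]. *)
apply: (card_extensions xD domD cardD) => k; exists (slack k) => l lk.
by exists x => //; apply: slack_high.
Qed.

(** If [S :\ x] is good, then [c x] is not [i0], so exactly one [y] in [S :\ x] shares the colour of
    [x]; removing [x] or [y], and nothing else, leaves a good set. *)
Let room_doors (S : {set X}) : #|S| = #|I| -> c @: S != setT ->
  2 %| #|[set x in S | good (S :\ x)]|.
Proof.
move=> cardS nc; set A := [set x in S | _].
have [->|[x]] := set_0Vmem A; first by rewrite cards0.
rewrite inE => /andP[xS /eqP gx].
have cx : c x != i0.
  apply: contraNneq nc => e; rewrite -(setD1K xS) imsetU1 gx e setUCr //.
have inj : {in S :\ x &, injective c}.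
  apply/imset_injP; rewrite gx -eqSS card_i0 -cardS.
  by rewrite (cardsD1 x S) xS.
have : c x \in c @: (S :\ x) by rewrite gx !inE.
move=> /imsetP[y]; rewrite !inE => /andP[yx yS] e.
have -> : A = [set x; y].
  apply/setP => z; rewrite !inE; apply/andP/orP.
    move=> [zS /eqP gz]; have [->|zx] := eqVneq z x; first by left.
    right; apply/negPn/negP => zy.
    have : c z \in c @: (S :\ z).
      rewrite gz -gx; apply: imset_f; by rewrite !inE zx.
    move=> /imsetP[w]; rewrite !inE => /andP[wz wS].
    have [->|wx] := eqVneq w x.
      by rewrite e => /inj E; move: zy; rewrite E ?inE ?zx ?yx // eqxx.
    by move=> /inj E; move: wz; rewrite E ?inE ?zx ?wx // eqxx.
  case=> /eqP->; first by rewrite xS /good gx.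
  split=> //; rewrite /good -gx; apply/eqP/setP => k.
  apply/imsetP/imsetP => -[w]; rewrite !inE => /andP[w1 wS] ->.
    have [->|wx] := eqVneq w x; first by exists y; rewrite // !inE yx.
    by exists w; rewrite // !inE wx.
  have [->|wy] := eqVneq w y; last by exists w; rewrite // !inE wy.
  by exists x; rewrite // !inE eq_sym yx.
by rewrite cards2 eq_sym yx.
Qed.

(** Count the pairs of a room and a door inside it. Without a colourful room, each room contributes
    an even number; but each door lies in two rooms, except [outer], which lies in one. *)
Theorem colourful_room :
  exists S : {set X}, [/\ dominant S, #|S| = #|I| & c @: S = setT].
Proof.
pose room S := dominant S && (#|S| == #|I|).
have [/existsP[S /and3P[dS /eqP cS /eqP cc]]|none] :=
  boolP [exists S, [&& dominant S, #|S| == #|I| & c @: S == setT]]; first by exists S.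
exfalso.
have even : 2 %| \sum_(S | room S) #|[set x in S | good (S :\ x)]|.
  apply: dvdn_sum => S /andP[dS /eqP cS]; apply: room_doors => //.
  by move: none; rewrite negb_exists => /forallP/(_ S); rewrite dS cS eqxx.
have odd : ~~ (2 %| \sum_(D | door D) #|extensions D|).
  rewrite (bigD1 outer) //= outer_ext dvdn_addl //.
  by apply: dvdn_sum => D /andP[dD nD]; rewrite (door_ext dD nD).
suff E : \sum_(S | room S) #|[set x in S | good (S :\ x)]| =
         \sum_(D | door D) #|extensions D| by move: odd; rewrite -E even.
transitivity (\sum_(x : X) \sum_(S | room S && ((x \in S) && good (S :\ x))) 1).
  rewrite (exchange_big_dep room) /=; last by move=> ? ? _ /andP[].
  apply: eq_bigr => S rS; rewrite -sum1_card; apply: eq_bigl => x.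
  by rewrite inE rS.
transitivity (\sum_(x : X) \sum_(D | door D && (x \in extensions D)) 1); last first.
  rewrite (exchange_big_dep door) /=; last by move=> ? ? _ /andP[].
  apply: eq_bigr => D dD; rewrite -sum1_card; apply: eq_bigl => x.
  by rewrite dD.
apply: eq_bigr => x _.
(* For fixed [x], rooms and doors correspond by removing and adding [x]. *)
rewrite (reindex_onto (fun D => x |: D) (fun S => S :\ x)) /=; last first.
  by move=> S /and3P[_ xS _]; rewrite setD1K.
apply: eq_bigl => D; rewrite /door /room !inE eqxx /=.
have [xD|xD] := boolP (x \in D).
  rewrite andbF; apply/negP => /andP[_ /eqP E].
  by move: xD; rewrite -E !inE eqxx.
rewrite setU1K // eqxx andbT /= cardsU1 xD add1n.
case: (boolP (dominant (x |: D))) => [dx|]; last by rewrite /= andbF.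
by rewrite (dominant_sub (subsetUr _ _) dx) andbT.
Qed.

End Scarf.

(** * Grid points of a simplex *)

Section Grid.
Variables (K : finType) (k0 : K) (N : nat) (c : (K -> nat) -> K).

Let T := {x : {ffun K -> 'I_N.+1} | \sum_k (x k : nat) == N}.
Let crd (x : T) (k : K) : nat := val x k.

Let crd_sum x : \sum_k crd x k = N.
Proof. exact: eqP (valP x). Qed.

Let crd_onto (f : K -> nat) : \sum_k f k = N -> exists x : T, crd x =1 f.
Proof.
move=> fN.
have fle k : f k < N.+1 by rewrite ltnS -fN (bigD1 k) //= leq_addr.
have H : \sum_k ([ffun k => inord (f k) : 'I_N.+1] k : nat) == N.
  by apply/eqP; rewrite -[RHS]fN; apply: eq_bigr => k _; rewrite ffunE inordK.
by exists (Sub [ffun k => inord (f k)] H) => k; rewrite /crd SubK ffunE inordK.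
Qed.

Let X := (T + K)%type.
(** Grid points have levels from 1 to [N.+1], so the slack element [inr j] is below all of them in
    order [j] and above all of them in the other orders. *)
Let lev (k : K) (z : X) : nat :=
  match z with inl x => (crd x k).+1 | inr j => if j == k then 0 else N.+2 end.
(* The rank breaks ties between equal coordinates. *)
Let r (k : K) (z : X) : nat := lev k z * #|{: X}| + enum_rank z.

Let cardX : 0 < #|{: X}|.
Proof. by apply/card_gt0P; exists (inr k0). Qed.

Let r_div k z : r k z %/ #|{: X}| = lev k z.
Proof. by rewrite /r divnMDl // divn_small ?addn0. Qed.

Let r_inj k : injective (r k).
Proof.
move=> y z e; apply: enum_rank_inj; apply: val_inj => /=.
have := congr1 (modn^~ #|{: X}|) e.
by rewrite /r !modnMDl !modn_small.
Qed.

Let r_lev k y z : r k y <= r k z -> lev k y <= lev k z.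
Proof. by move=> h; rewrite -!r_div leq_div2r. Qed.

Let lev_r k y z : lev k y < lev k z -> r k y < r k z.
Proof. by move=> h; rewrite ltnNge; apply/negP => /r_lev; rewrite leqNgt h. Qed.

Let col (z : X) : K := match z with inl x => c (crd x) | inr j => j end.

Let slack_low k z : r k (inr k) <= r k z.
Proof.
have [->//|zk] := eqVneq z (inr k); apply/ltnW/lev_r; rewrite /= eqxx.
by case: z zk => //= j zk; case: (eqVneq j k) zk => // ->; rewrite eqxx.
Qed.

Let slack_high i j z : i != j -> z \notin codom (@inr T K) ->
  r i z < r i (inr j).
Proof.
case: z => [x|k] ij; last by rewrite codom_f.
move=> _; apply: lev_r; rewrite /= eq_sym (negbTE ij) !ltnS.
by rewrite -(crd_sum x) (bigD1 i) //= leq_addr.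
Qed.

(** In a colourful room, colour [k] is carried either by the slack [inr k], which makes the [k]-th
    coordinates small, or by a grid point; dominance keeps the grid points of the room close
    together. *)
Lemma grid_colouring : exists x0 : K -> nat, \sum_k x0 k = N /\
  forall k, x0 k < #|K| \/
    exists x : K -> nat, [/\ \sum_k x k = N, c x = k &
      forall l, x l < x0 l + #|K| /\ x0 l < x l + #|K|].
Proof.
have [e1 _] : exists x : T, crd x =1 (fun k => if k == k0 then N else 0).
  by apply: crd_onto; rewrite -big_mkcond big_pred1_eq.
have e1P : inl e1 \notin codom (@inr T K) by apply/codomP => -[].
have [S [dS _ cS]] := colourful_room r_inj k0 slack_low slack_high
  (c := col) (fun=> erefl) e1P.
(* An order whose slack is in [S] cannot serve here: that slack has level 0. *)
have dom (y : T) : exists2 i, inr i \notin S &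
    forall x : T, inl x \in S -> crd y i <= crd x i.
  have /dominantP/(_ (inl y))[i Hi] := dS.
  exists i; first by apply/negP => /Hi/r_lev; rewrite /= eqxx.
  by move=> x /Hi/r_lev.
have pick i : inr i \notin S -> exists2 x : T, inl x \in S & c (crd x) = i.
  move=> iS; have : i \in col @: S by rewrite cS inE.
  by move=> /imsetP[[x|j] zS /= E]; [exists x|move: iS; rewrite E zS].
have [i1 /pick[a0 a0S _] _] := dom e1.
(* The value 0 at slack coordinates turns [near] into the bound [x0 k < #|K|] there. *)
pose mn k := if inr k \in S then 0
             else crd [arg min_(x < a0 | inl x \in S) crd x k] k.
have mn_le x k : inl x \in S -> mn k <= crd x k.
  rewrite /mn => xS; case: ifP => // _.
  by case: arg_minnP => // y _ /(_ x xS).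
have mn_at k : inr k \notin S -> exists2 x : T, inl x \in S & crd x k = mn k.
  rewrite /mn => /negbTE ->; case: arg_minnP => // y yS _.
  by exists y.
have mnN : N < \sum_k mn k + #|K|.
  rewrite ltnNge; apply/negP => le.
  have {}le : \sum_k (mn k).+1 <= N.
    apply: leq_trans le; rewrite -sum1_card -big_split /=.
    by apply: leq_sum => k _; rewrite addn1.
  (* If the values [(mn k).+1] fit into [N], putting the excess on [k0] gives a grid point exceeding
     [mn] everywhere, against dominance. *)
  have [|y Hy] := @crd_onto (fun k => (mn k).+1 +
      if k == k0 then N - \sum_k (mn k).+1 else 0).
    by rewrite big_split /= -[X in _ + X]big_mkcond big_pred1_eq subnKC.
  have [i iS Hi] := dom y.
  have [x xS xi] := mn_at i iS.
  by have := Hi x xS; rewrite Hy xi addSn ltnNge leq_addr.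
have near x l : inl x \in S -> crd x l < mn l + #|K|.
  move=> xS; move: mnN; rewrite -(crd_sum x) (bigD1 l) //= [\sum_k mn k](bigD1 l) //=.
  have : \sum_(k | k != l) mn k <= \sum_(k | k != l) crd x k.
    by apply: leq_sum => k _; apply: mn_le.
  lia.
exists (crd a0); split=> // k; have [kS|kS] := boolP (inr k \in S).
  by left; have := near a0 k a0S; rewrite /mn kS.
right; have [x xS cx] := pick k kS; exists (crd x); split=> // l.
by split; apply: leq_trans (near _ l _) _; rewrite // leq_add2r mn_le.
Qed.
End Grid.

Local Open Scope ring_scope.

(** * Limits and continuity *)

(** The cube is compact by Tychonoff's theorem, and finiteness of [K] makes the box of radius [e]
    around [x] a neighbourhood. *)
Lemma cluster_point (R : realType) (K : finType) (M : R) (u : nat -> K -> R) :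
  (forall n k, 0 <= u n k <= M) ->
  exists x : K -> R, forall e : R, 0 < e -> forall N, exists2 n, (N <= n)%N &
    forall k, `|u n k - x k| < e.
Proof.
move=> ub.
have cpt := @tychonoff K (fun=> R) (fun=> `[0, M]%classic) (fun=> @segment_compact R 0 M).
have [|x [_ cl]] := cpt ((u : nat -> prod_topology (fun=> R)) @ \oo)%classic _.
  by exists 0%N => // n _ k; rewrite /= in_itv; exact: ub.
exists x => e e0 N.
have [||y [[n /= Nn <-] /= yx]] := cl (u @` [set n | (N <= n)%N])%classic
  [set y : prod_topology (fun=> R) | forall k, `|y k - x k| < e]%classic.
- by exists N => // n /= Nn; exists n.
- have FF : Filter (nbhs x) by exact: nbhs_filter.
  apply: (@filter_forall _ K (fun k y => `|y k - x k| < e) _ FF) => k.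
  have := @proj_continuous K (fun=> R) k x.
  move=> /cvgrPdist_lt/(_ e e0); apply: filterS => y.
  by rewrite /mathcomp_extra.proj distrC.
by exists n.
Qed.

Section Continuity.
Variables (R : realType) (K : finType).
Implicit Types (D : (K -> R) -> Prop) (f : (K -> R) -> R).

(** The domain is a parameter, to serve both simplices and flows; for feasible flows this is
    [continuous_on_F]. *)
Definition cont_on D f : Prop :=
  forall x, D x -> forall eps : R, 0 < eps ->
    exists2 del : R, 0 < del & forall y, D y ->
      (forall a, `|y a - x a| < del) -> `|f y - f x| < eps.

Lemma cont_on_coord D k : cont_on D (fun x => x k).
Proof. by move=> x _ e e0; exists e. Qed.

Lemma cont_on_cst D a : cont_on D (fun=> a).
Proof. by move=> x _ e e0; exists 1 => // y _ _; rewrite subrr normr0. Qed.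

Lemma cont_on_eq D f f' : (forall x, D x -> f x = f' x) ->
  cont_on D f -> cont_on D f'.
Proof.
move=> E cf x Dx e e0; have [del d0 H] := cf x Dx e e0.
by exists del => // y Dy /(H y Dy); rewrite !E.
Qed.

Lemma cont_onD D f f' : cont_on D f -> cont_on D f' ->
  cont_on D (fun x => f x + f' x).
Proof.
move=> cf cf' x Dx e e0; have e2 : 0 < e / 2 by rewrite divr_gt0.
have [d1 d10 H1] := cf x Dx _ e2; have [d2 d20 H2] := cf' x Dx _ e2.
exists (Num.min d1 d2); first by rewrite lt_min d10.
move=> y Dy near; rewrite opprD addrACA (splitr e).
apply: le_lt_trans (ler_normD _ _) (ltrD _ _).
  by apply: H1 => // a; move: (near a); rewrite lt_min => /andP[].
by apply: H2 => // a; move: (near a); rewrite lt_min => /andP[].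
Qed.

Lemma cont_onZ D f a : cont_on D f -> cont_on D (fun x => a * f x).
Proof.
move=> cf x Dx e e0; have a0 : 0 < `|a| + 1 by rewrite ltr_wpDl.
have [del d0 H] := cf x Dx _ (divr_gt0 e0 a0).
exists del => // y Dy /(H y Dy); rewrite ltr_pdivlMr // -mulrBr normrM mulrC.
by apply: le_lt_trans; rewrite ler_wpM2r // lerDl.
Qed.

Lemma cont_on_sum D (L : finType) (Q : pred L) (F : L -> (K -> R) -> R) :
  (forall l, cont_on D (F l)) -> cont_on D (fun x => \sum_(l | Q l) F l x).
Proof.
move=> cF; elim: (index_enum L) => [|l s IH].
  by apply: cont_on_eq (@cont_on_cst D 0) => x _; rewrite big_nil.
have [Ql|Ql] := boolP (Q l).
  by apply: cont_on_eq (cont_onD (cF l) IH) => x _; rewrite big_cons Ql.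
by apply: cont_on_eq IH => x _; rewrite big_cons (negbTE Ql).
Qed.

Lemma sum_dist_le (Q : pred K) (x y : K -> R) e :
  0 <= e -> (forall k, `|y k - x k| <= e) ->
  `|\sum_(k | Q k) y k - \sum_(k | Q k) x k| <= #|K|%:R * e.
Proof.
move=> e0 H; rewrite -sumrB; apply: le_trans (ler_norm_sum _ _ _) _.
apply: (@le_trans _ _ (\sum_(k : K) e)); last by rewrite sumr_const mulr_natl.
by rewrite big_mkcond; apply: ler_sum => k _; case: ifP.
Qed.

Lemma limit_sum (Q : pred K) (x : K -> R) (s : R) :
  (forall e : R, 0 < e -> exists2 y, \sum_(k | Q k) y k = s &
     forall k, `|y k - x k| < e) -> \sum_(k | Q k) x k = s.
Proof.
move=> H; apply/eqP; rewrite -subr_eq0 -normr_le0; apply/ler_addgt0Pr => e e0.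
have q0 : 0 < #|K|%:R + 1 :> R by rewrite ltr_wpDl.
have e'0 := divr_gt0 e0 q0.
have [y <- yx] := H _ e'0; rewrite distrC add0r.
apply: le_trans (sum_dist_le _ (ltW e'0) (fun k => ltW (yx k))) _.
by rewrite mulrCA ler_piMr ?(ltW e0) // ler_pdivrMr // mul1r lerDl.
Qed.

Lemma limit_ge0 (x : K -> R) k :
  (forall e : R, 0 < e -> exists2 y : K -> R, 0 <= y k & `|y k - x k| < e) ->
  0 <= x k.
Proof.
move=> H; apply/ler_addgt0Pr => e /H[y y0].
by rewrite ltr_norml => /andP[_ ?]; lra.
Qed.

End Continuity.

(** * Equilibria on a simplex *)

Section SimplexEquilibrium.
Variables (R : realType) (K : finType).

Definition simplex (x : K -> R) : Prop := (forall k, 0 <= x k) /\ \sum_k x k = 1.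

Let pt (n : nat) (x : K -> nat) (k : K) : R := (x k)%:R / n.+1%:R.

Let pt_simplex n x : (\sum_k x k = n.+1)%N -> simplex (pt n x).
Proof.
move=> sx; split=> [k|]; first by rewrite divr_ge0.
by rewrite -mulr_suml -natr_sum sx divff ?pnatr_eq0.
Qed.

Let pt_close n (x y : K -> nat) k : (x k < y k + #|K|)%N -> (y k < x k + #|K|)%N ->
  `|pt n x k - pt n y k| < #|K|%:R / n.+1%:R.
Proof.
move=> h1 h2; rewrite -mulrBl normrM [`|_^-1|]ger0_norm ?invr_ge0 //.
rewrite ltr_pM2r ?invr_gt0 // ltr_norml.
by move: h1 h2; rewrite -!(ltr_nat R) !natrD => ? ?; lra.
Qed.

(** Let [x] be a cluster point of the grid points from [grid_colouring] as the mesh shrinks. If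
    [0 < x k], there are points arbitrarily close to [x] where [k] is cheapest, and continuity
    passes this to [x]. *)
Theorem simplex_equilibrium (k0 : K) (cost : K -> (K -> R) -> R) :
  (forall k, cont_on simplex (cost k)) ->
  exists x, simplex x /\ forall k l, 0 < x k -> cost k x <= cost l x.
Proof.
move=> ccost.
pose best n (x : K -> nat) := [arg min_(k < k0) cost k (pt n x)]%O.
have bestP n x l : cost (best n x) (pt n x) <= cost l (pt n x).
  by rewrite /best; case: arg_minP => // i _; apply.
have [u Hu] := choice (fun n => grid_colouring k0 n.+1 (best n)).
have ptu n : simplex (pt n (u n)) by apply: pt_simplex; case: (Hu n).
have [|x Hx] := @cluster_point R K 1 (fun n => pt n (u n)).
  move=> n k; have [p0 <-] := ptu n; rewrite p0 (bigD1 k) //= lerDl.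
  by rewrite sumr_ge0.
have sx : simplex x.
  split=> [k|].
    apply: limit_ge0 => e /Hx/(_ 0)[n _ H]; exists (pt n (u n)) => //.
    by case: (ptu n).
  apply: limit_sum => e /Hx/(_ 0)[n _ H]; exists (pt n (u n)) => //.
  by case: (ptu n).
exists x; split=> // k l xk.
suff main (e : R) : 0 < e -> cost k x <= cost l x + e by apply/ler_addgt0Pr.
move=> e0.
have e2 : 0 < e / 2 by rewrite divr_gt0.
have [d1 d10 H1] := ccost k x sx _ e2; have [d2 d20 H2] := ccost l x sx _ e2.
(* Halved because the point of colour [k] is reached from [x] in two steps, via [pt n (u n)], each
   shorter than [del]. *)
pose del : R := Num.min (Num.min d1 d2) (x k) / 2.
have del0 : 0 < del by rewrite divr_gt0 // !lt_min d10 d20.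
have [dd1 dd2 ddx] : [/\ del * 2 <= d1, del * 2 <= d2 & del * 2 <= x k].
  rewrite /del divfK ?pnatr_eq0 //.
  by split; rewrite !ge_min lexx ?orbT.
have [n Nn near] := Hx del del0 (Num.bound (#|K|%:R / del)).
have small : #|K|%:R / n.+1%:R < del.
  rewrite ltr_pdivrMr // mulrC -ltr_pdivrMr //.
  apply: lt_le_trans (archi_boundP _) _; first by rewrite divr_ge0 // ltW.
  by rewrite ler_nat; apply: leq_trans Nn _.
(* The first alternative would put the [k]-th coordinate of [pt n (u n)] below [del], too far from
   [x k]. *)
have [_ /(_ k)[uk|[y [sy by_k close]]]] := Hu n.
  have : pt n (u n) k < del.
    by apply: lt_trans small; rewrite ltr_pM2r ?invr_gt0 // ltr_nat.
  by have := near k; rewrite ltr_norml => /andP[? ?] ?; lra.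
have yx a : `|pt n y a - x a| < del * 2.
  rewrite -(subrKA (pt n (u n) a)) mulr_natr mulr2n.
  apply: le_lt_trans (ler_normD _ _) (ltrD _ (near a)).
  by apply: lt_trans small; have [? ?] := close a; apply: pt_close.
have := H1 _ (pt_simplex sy) (fun a => lt_le_trans (yx a) dd1).
have := H2 _ (pt_simplex sy) (fun a => lt_le_trans (yx a) dd2).
have := bestP n y l; rewrite by_k !ltr_norml.
move: (cost k (pt n y)) (cost l (pt n y)) (cost k x) (cost l x) => p q v w.
move=> ? /andP[? ?] /andP[? ?]; lra.
Qed.

(* The equilibrium for the costs [z_k . sum_l x_l z_l] is the point of least
   norm in the convex hull of the [z_k]. *)
Theorem gordan (J : finType) (z : K -> J -> R) :
  (exists lam : J -> R, forall k, 0 < \sum_j lam j * z k j) \/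
  (exists x, simplex x /\ forall j, \sum_k x k * z k j = 0).
Proof.
have [k0 _|none] := pickP (@predT K); last first.
  by left; exists (fun=> 0) => k; have := none k.
pose p (x : K -> R) j := \sum_k x k * z k j.
have [|x [sx eqx]] :=
    @simplex_equilibrium k0 (fun k x => \sum_j p x j * z k j).
  move=> k; apply: cont_on_sum => j.
  apply: (cont_on_eq (f := fun x => z k j * \sum_l z l j * x l)).
    move=> y _; rewrite mulrC; congr (_ * _).
    by apply: eq_bigr => l _; rewrite mulrC.
  by apply/cont_onZ/cont_on_sum => l; apply/cont_onZ/cont_on_coord.
(* The mean cost is the squared norm of [p x]; in equilibrium it is the least cost, which gives
   [le]. So [p x] is either zero or the functional sought. *)
have pp : \sum_k x k * (\sum_j p x j * z k j) = \sum_j p x j ^+ 2.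
  under eq_bigr do rewrite mulr_sumr.
  rewrite exchange_big /=; apply: eq_bigr => j _.
  rewrite expr2 {2}/p mulr_sumr; apply: eq_bigr => k _; exact: mulrCA.
have le l : \sum_j p x j ^+ 2 <= \sum_j p x j * z l j.
  rewrite -pp -[leRHS]mul1r -(proj2 sx) mulr_suml; apply: ler_sum => k _.
  have := proj1 sx k; rewrite le_eqVlt => /orP[/eqP<-|xk]; first by rewrite !mul0r.
  by rewrite ler_pM2l //; apply: eqx.
have sq0 j : 0 <= p x j ^+ 2 by exact: sqr_ge0.
have [/eqP p0|p0] := eqVneq (\sum_j p x j ^+ 2) 0.
  right; exists x; split=> // j; move: p0.
  rewrite psumr_eq0 // => /allP/(_ j); rewrite mem_index_enum sqrf_eq0.
  by move=> /(_ isT)/eqP.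
left; exists (p x) => k; apply: lt_le_trans (le k).
by rewrite lt_def p0 sumr_ge0.
Qed.

End SimplexEquilibrium.

(** * Flows *)

Lemma cont_on_comp (R : realType) (K P : finType) (D : (K -> R) -> Prop)
  (D' : (P -> R) -> Prop) (h : (K -> R) -> P -> R) (f : (P -> R) -> R) :
  (forall x, D x -> D' (h x)) -> (forall a, cont_on D (h^~ a)) ->
  cont_on D' f -> cont_on D (fun x => f (h x)).
Proof.
move=> hD ch cf x Dx e e0; have [d' d'0 Hf] := cf _ (hD x Dx) e e0.
have /choice[del Hdel] a : exists del : R, 0 < del /\ forall y, D y ->
    (forall b, `|y b - x b| < del) -> `|h y a - h x a| < d'.
  by have [del d0 H] := ch a x Dx d' d'0; exists del.
(* The cap 1 covers an empty [P]. *)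
exists (\big[Num.min/1]_a del a).
  by apply: lt_bigmin => [|a _]; [exact: ltr01|case: (Hdel a)].
move=> y Dy near; apply: Hf; first exact: hD.
move=> a; apply: (proj2 (Hdel a)) => // b.
by apply: lt_le_trans (near b) _; apply: bigmin_le_cond.
Qed.

Section Flows.
Variables (R : realType) (P I : finType) (tg : P -> I) (d : I -> R).
Hypothesis d_gt0 : forall i, 0 < d i.
Implicit Types (x u v : P -> R).

Definition flow x : Prop :=
  (forall a, 0 <= x a) /\ (forall i, \sum_(a | tg a == i) x a = d i).

Lemma flow_support x i : flow x -> exists a, tg a = i /\ 0 < x a.
Proof.
move=> [x0 xd]; have : 0 < \sum_(a | tg a == i) x a by rewrite xd.
rewrite lt_def => /andP[/eqP nz _].
have [/existsP[a /andP[/eqP ta xa]]|none] := boolP [exists a, (tg a == i) && (0 < x a)].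
  by exists a.
exfalso; apply: nz; apply: big1 => a ta; apply/eqP.
move: none; rewrite negb_exists => /forallP/(_ a); rewrite ta /= -leNgt => le.
by rewrite eq_le le x0.
Qed.

Lemma flow_sum_tag (H : I -> R) x : flow x ->
  \sum_a H (tg a) * x a = \sum_i H i * d i.
Proof.
move=> [_ xd]; rewrite (partition_big tg predT) //=; apply: eq_bigr => i _.
by rewrite -xd mulr_sumr; apply: eq_bigr => a /eqP->.
Qed.

(** Both totals are compared with the cost of sending each demand along one path [p i] used by
    [u]. *)
Lemma flow_min_support (phi : P -> R) u v : flow u -> flow v ->
  (forall a b, tg a = tg b -> 0 < u a -> phi a <= phi b) ->
  \sum_a phi a * u a <= \sum_a phi a * v a.
Proof.
move=> fu fv umin; have /choice[p pP] := fun i => flow_support i fu.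
apply: (@le_trans _ _ (\sum_i phi (p i) * d i)).
  rewrite -(flow_sum_tag (fun i => phi (p i)) fu); apply: ler_sum => a _.
  have := fu.1 a; rewrite le_eqVlt => /orP[/eqP<-|ua]; first by rewrite !mulr0.
  by rewrite ler_pM2r // umin // (pP _).1.
rewrite -(flow_sum_tag (fun i => phi (p i)) fv); apply: ler_sum => a _.
by rewrite ler_wpM2r ?fv.1 // umin ?(pP _).1 ?(pP _).2.
Qed.

Lemma flow_mix (L : finType) (c : L -> R) (v : L -> P -> R) :
  simplex c -> (forall l, flow (v l)) -> flow (fun a => \sum_l c l * v l a).
Proof.
move=> [c0 c1] fv; split=> [a|i].
  by apply: sumr_ge0 => l _; rewrite mulr_ge0 ?(fv l).1.
rewrite exchange_big /= -[RHS]mul1r -c1 mulr_suml; apply: eq_bigr => l _.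
by rewrite -mulr_sumr (fv l).2.
Qed.

(** Otherwise flows [u n] with [n%:R < |f (u n)|] would cluster at a flow, near which continuity
    bounds [f]. *)
Lemma flow_bounded (f : (P -> R) -> R) : cont_on flow f ->
  exists M, forall x, flow x -> `|f x| <= M.
Proof.
move=> cf; apply: contrapT => nb.
have /choice[u Hu] n : exists u, flow u /\ n%:R < `|f u|.
  apply: contrapT => nu; apply: nb; exists n%:R => x fx.
  by rewrite leNgt; apply/negP => lt; apply: nu; exists x.
have [|x Hx] := @cluster_point R P (\sum_i d i) u.
  move=> n a; have [[u0 ud] _] := Hu n; rewrite u0 /=.
  apply: (@le_trans _ _ (d (tg a))).
    by rewrite -ud (bigD1 a) //= lerDl sumr_ge0.
  by rewrite (bigD1 (tg a)) //= lerDl sumr_ge0 // => i _; apply/ltW.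
have fx : flow x.
  split=> [a|i].
    by apply: limit_ge0 => e /Hx/(_ 0)[n _ H]; exists (u n); rewrite // (Hu n).1.1.
  by apply: limit_sum => e /Hx/(_ 0)[n _ H]; exists (u n); rewrite // (Hu n).1.2.
have [del d0 H] := cf x fx 1 ltr01.
have [n Nn near] := Hx del d0 (Num.bound (`|f x| + 1)).
have [fu nu] := Hu n; have := H _ fu near.
have := @archi_boundP _ (`|f x| + 1) (addr_ge0 (normr_ge0 _) ler01).
have : (Num.bound (`|f x| + 1))%:R <= n%:R :> R by rewrite ler_nat.
have := ler_normD (f (u n) - f x) (f x); rewrite subrK.
by move: nu; lra.
Qed.

Section Assignments.
Variables (p0 : I -> P) (tg_p0 : forall i, tg (p0 i) = i).

Notation K := {ffun I -> P}.

(* A choice of one path per commodity; values with the wrong tag are replaced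
   by a default, so that every finite function encodes such a choice. *)
Definition sel (s : K) (i : I) : P := if tg (s i) == i then s i else p0 i.

Lemma tg_sel s i : tg (sel s i) = i.
Proof. by rewrite /sel; case: eqP. Qed.

Definition pure (s : K) (a : P) : R := if sel s (tg a) == a then d (tg a) else 0.

Lemma pure_sum s (F : P -> R) :
  \sum_a F a * pure s a = \sum_i d i * F (sel s i).
Proof.
under eq_bigr do rewrite /pure (fun_if (fun y => _ * y)) mulr0.
rewrite -big_mkcond (reindex_onto (sel s) tg) /=; last by move=> a /eqP.
apply: eq_big => [i|i _]; first by rewrite tg_sel !eqxx.
by rewrite tg_sel mulrC.
Qed.

Lemma pure_flow s : flow (pure s).
Proof.
split=> [a|i]; first by rewrite /pure; case: ifP => // _; apply/ltW.
transitivity (\sum_a (tg a == i)%:R * pure s a).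
  rewrite big_mkcond; apply: eq_bigr => a _.
  by case: eqP; rewrite ?mul1r ?mul0r.
rewrite pure_sum (bigD1 i) //= tg_sel eqxx mulr1 big1 ?addr0 // => j ji.
by rewrite tg_sel (negbTE ji) mulr0.
Qed.

Lemma mix_pure_sum (z : K -> R) (F : P -> R) :
  \sum_a F a * (\sum_s z s * pure s a) =
  \sum_s z s * (\sum_i d i * F (sel s i)).
Proof.
under eq_bigr do rewrite mulr_sumr.
rewrite exchange_big /=; apply: eq_bigr => s _; rewrite -pure_sum mulr_sumr.
by apply: eq_bigr => a _; rewrite mulrCA.
Qed.

(** Choose the paths of the commodities independently, path [a] with probability [u a / d i]: the
    product weights [z] have the right marginals. *)
Lemma flow_decomposition u : flow u ->
  exists2 z, simplex z & forall a, \sum_s z s * pure s a = u a.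
Proof.
move=> [u0 ud].
pose f i a := if tg a == i then u a / d i else 0.
have f1 i : \sum_a f i a = 1.
  by rewrite -big_mkcond -mulr_suml ud divff // gt_eqF.
pose z (s : K) := \prod_i f i (s i).
exists z.
  split=> [s|]; last by rewrite -bigA_distr_bigA big1.
  apply: prodr_ge0 => i _; rewrite /f; case: ifP => // _.
  by rewrite divr_ge0 // ltW.
move=> a; set i := tg a.
(* [h] builds the condition [s i = a] into factor [i], so the sum over [s] still factors. A wrong
   tag at [i] makes [z s] vanish, so the default in [sel] does no harm. *)
pose h j b := if j == i then (if b == a then f j b else 0) else f j b.
have zh s : (if sel s i == a then z s else 0) = \prod_j h j (s j).
  rewrite /z (bigD1 i) //= [RHS](bigD1 i) //= {1}/h eqxx.
  have -> : \prod_(j | j != i) h j (s j) = \prod_(j | j != i) f j (s j).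
    by apply: eq_bigr => j /negbTE ji; rewrite /h ji.
  rewrite /sel; have [ti|ti] := eqVneq (tg (s i)) i.
    by case: ifP; rewrite ?mul0r.
  by rewrite /f (negbTE ti) !if_same mul0r; case: ifP.
transitivity (\sum_(s : K) d i * \prod_j h j (s j)).
  apply: eq_bigr => s _; rewrite -zh /pure -/i; case: ifP => _.
    by rewrite mulrC.
  by rewrite !mulr0.
rewrite -mulr_sumr -bigA_distr_bigA (bigD1 i) //= [X in _ * (_ * X)]big1.
  rewrite mulr1; under eq_bigr do rewrite /h eqxx.
  by rewrite -big_mkcond big_pred1_eq /f eqxx mulrC divfK // gt_eqF.
by move=> j /negbTE ji; rewrite -(f1 j); apply: eq_bigr => b _; rewrite /h ji.
Qed.

(** Take an equilibrium on the simplex of mixtures of pure flows, pricing an assignment by its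
    demand-weighted path costs. *)
Theorem flow_equilibrium (c : P -> (P -> R) -> R) :
  (forall a, cont_on flow (c a)) ->
  exists x, flow x /\ forall a b, tg a = tg b -> 0 < x a -> c a x <= c b x.
Proof.
move=> cc; pose mix (z : K -> R) a := \sum_s z s * pure s a.
have mixP z : simplex z -> flow (mix z) by move=> sz; apply: flow_mix pure_flow.
have [|z [sz zeq]] := @simplex_equilibrium R K [ffun i => p0 i]
    (fun s z => \sum_i d i * c (sel s i) (mix z)).
  move=> s; apply: cont_on_sum => i; apply: cont_onZ.
  apply: (cont_on_comp mixP) (cc _) => a; apply: cont_on_sum => s'.
  by apply: (cont_on_eq (f := fun z => pure s' a * z s')) => [y _|];
    [rewrite mulrC|apply/cont_onZ/cont_on_coord].
exists (mix z); split=> [|a b tab xa]; first exact: mixP.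
have [s sa zs] : exists2 s, sel s (tg a) = a & 0 < z s.
  have [/existsP[s /andP[/eqP ? ?]]|none] :=
    boolP [exists s, (sel s (tg a) == a) && (0 < z s)]; first by exists s.
  exfalso; move: xa; rewrite /mix big1 ?ltxx // => s _; rewrite /pure.
  case: ifP => [sa|]; last by rewrite mulr0.
  move: none; rewrite negb_exists => /forallP/(_ s); rewrite sa /= -leNgt => le.
  by have /eqP -> : z s == 0; rewrite ?mul0r // eq_le le sz.1.
(* Rerouting only the commodity of [a] makes all other terms cancel in the comparison of [s] with
   [s']. *)
pose s' : K := [ffun j => if j == tg a then b else s j].
have := zeq s s' zs; rewrite (bigD1 (tg a)) //= [leRHS](bigD1 (tg a)) //=.
rewrite sa [sel s' _]/sel ffunE eqxx -tab eqxx.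
have -> : \sum_(i | i != tg a) d i * c (sel s' i) (mix z) =
          \sum_(i | i != tg a) d i * c (sel s i) (mix z).
  by apply: eq_bigr => i /negbTE ia; rewrite /sel ffunE ia.
by rewrite lerD2r ler_pM2l.
Qed.

End Assignments.
End Flows.

(** * Exposed budgets *)

Section Exposed.
Variables (R : realType) (L J : finType) (w : L -> J -> R) (B : J -> R).

(* A vertex [B] of the convex hull of the [w l], minimal for the product order,
   is exposed by a positive functional. *)
Lemma exposed_vertex :
  (forall c, simplex c -> (forall j, \sum_l c l * w l j <= B j) ->
     forall j, \sum_l c l * w l j = B j) ->
  (forall l c mu, simplex c -> 0 < mu < 1 ->
     (forall j, B j = mu * w l j + (1 - mu) * \sum_l c l * w l j) ->
     forall j, w l j = \sum_l c l * w l j) ->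
  exists lam : J -> R, (forall j, 0 < lam j) /\
    forall l, (forall j, w l j = B j) \/ 0 < \sum_j lam j * (w l j - B j).
Proof.
move=> minB extB.
(* Gordan's theorem is applied to the nonzero [w l - B] together with the unit vectors; the latter
   force [lam] to be positive. *)
pose T := {l : L | [exists j, w l j != B j]}.
pose z (y : T + J) (j : J) :=
  match y with inl t => w (val t) j - B j | inr j' => (j' == j)%:R end.
have [[lam Hlam]|[y [[y0 y1] yz]]] := gordan z.
  exists lam; split=> [j|l].
    have := Hlam (inr j); rewrite (bigD1 j) //= eqxx mulr1 big1 ?addr0 // => k kj.
    by rewrite eq_sym (negbTE kj) mulr0.
  have [bad|good] := boolP [exists j, w l j != B j].
    by right; apply: (Hlam (inl (Sub l bad))).
  by left=> j; apply/eqP; move: good; rewrite negb_exists => /forallP/(_ j)/negPn.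
exfalso; pose C := \sum_t y (inl t).
have yzE j : \sum_t y (inl t) * (w (val t) j - B j) + y (inr j) = 0.
  rewrite -[RHS](yz j) big_sumType /=; congr (_ + _).
  rewrite (bigD1 j) //= eqxx mulr1 big1 ?addr0 // => k kj.
  by rewrite (negbTE kj) mulr0.
have C_gt0 : 0 < C.
  rewrite lt_def sumr_ge0 // andbT; apply/eqP => C0.
  have yt t : y (inl t) = 0.
    by move/eqP: C0; rewrite psumr_eq0 // => /allP/(_ t (mem_index_enum _))/eqP.
  have yj j : y (inr j) = 0.
    by have := yzE j; rewrite big1 ?add0r // => t _; rewrite yt mul0r.
  move: y1; rewrite big1 => [/esym/eqP|[t|j] _ //]; first by rewrite oner_eq0.
(* Normalising the weights on the differences gives a convex combination of the [w l] below [B],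
   hence equal to [B] by minimality. *)
pose c l := \sum_(t : T | val t == l) y (inl t) / C.
have sum_c (F : L -> R) : \sum_l c l * F l = (\sum_t y (inl t) * F (val t)) / C.
  rewrite mulr_suml (partition_big val predT) //=; apply: eq_bigr => l _.
  by rewrite mulr_suml; apply: eq_bigr => t /eqP <-; rewrite mulrAC.
have sc : simplex c.
  split=> [l|]; first by apply: sumr_ge0 => t _; rewrite divr_ge0 // ltW.
  have := sum_c (fun=> 1); under eq_bigr do rewrite mulr1.
  by move=> ->; under eq_bigr do rewrite mulr1; rewrite divff // gt_eqF.
have cw j : \sum_l c l * w l j = B j - y (inr j) / C.
  rewrite sum_c; apply: (mulIf (lt0r_neq0 C_gt0)).
  rewrite mulrBl !divfK ?lt0r_neq0 //; have := yzE j.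
  under eq_bigr do rewrite mulrBr; rewrite sumrB -mulr_suml -/C => h.
  by lra.
have cB j : \sum_l c l * w l j = B j.
  by apply: minB => // k; rewrite cw gerBl divr_ge0 // ltW.
have [t t_gt0] : exists t, 0 < y (inl t).
  apply: contrapT => none; move: C_gt0; rewrite /C big1 ?ltxx // => t _.
  apply/eqP; rewrite eq_le y0 andbT leNgt; apply/negP => h.
  by apply: none; exists t.
set l := val t.
have cl_gt0 : 0 < c l.
  rewrite /c (bigD1 t) //= ltr_wpDr ?divr_gt0 // sumr_ge0 // => t' _.
  by rewrite divr_ge0 // ltW.
have cl_le1 : c l <= 1.
  by rewrite -sc.2 (bigD1 l) //= lerDl sumr_ge0 // => k _; apply: sc.1.
(* Only half the weight of [l] is split off, so that [mu < 1] even when [c l = 1]; [c'] is the rest,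
   renormalised. Extremality then forces [w l = B], against the choice of [t]. *)
pose mu := c l / 2.
have mu01 : 0 < mu < 1 by rewrite /mu; apply/andP; split; lra.
have /andP[mu0 mu1] := mu01.
have nu0 : 1 - mu != 0 by rewrite subr_eq0 eq_sym lt_eqF.
pose c' k := (c k - (if k == l then mu else 0)) / (1 - mu).
have sum_c' (F : L -> R) : \sum_k c' k * F k = (\sum_k c k * F k - mu * F l) / (1 - mu).
  rewrite [X in _ - X](_ : _ = \sum_k (if k == l then mu else 0) * F k).
    rewrite -sumrB mulr_suml; apply: eq_bigr => k _.
    by rewrite /c' mulrAC mulrBl.
  by rewrite (bigD1 l) //= eqxx big1 ?addr0 // => k /negbTE ->; rewrite mul0r.
have sc' : simplex c'.
  split=> [k|].
    rewrite divr_ge0 ?subr_ge0 ?(ltW mu1) //; case: eqVneq => [->|_].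
      by rewrite /mu; lra.
    exact: sc.1.
  have := sum_c' (fun=> 1); under eq_bigr do rewrite mulr1.
  by move=> ->; under eq_bigr do rewrite mulr1; rewrite sc.2 mulr1 divff.
have /existsP[j /eqP] := valP t; apply.
have wc' k : B k = mu * w l k + (1 - mu) * \sum_i c' i * w i k.
  by rewrite sum_c' cB (mulrC (1 - mu)) divfK // [RHS]addrC subrK.
have E := extB l c' mu sc' mu01 wc' j.
by rewrite (wc' j) -E -/l -mulrDl addrC subrK mul1r.
Qed.
End Exposed.

(** * Scaled prices and strict implementability *)

Lemma scale_beats_gaps (R : realFieldType) (P : finType) (phi : P -> R) (T : R) :
  0 <= T -> exists2 M, 0 < M &
    forall a b, phi b < phi a -> T < M * (phi a - phi b).
Proof.
move=> T0; pose q (ab : P * P) := if phi ab.2 < phi ab.1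
  then T / (phi ab.1 - phi ab.2) else 0.
have q0 ab : 0 <= q ab.
  by rewrite /q; case: ifP => // h; rewrite divr_ge0 // subr_ge0 ltW.
(* This exceeds each single quotient of [T] by a positive gap. *)
exists (1 + \sum_ab q ab); first by rewrite ltr_wpDr ?sumr_ge0.
move=> a b ab; have gap : 0 < phi a - phi b by rewrite subr_gt0.
rewrite -ltr_pdivrMr // (bigD1 (a, b)) //= {1}/q /= ab.
by rewrite [ltRHS]addrCA ltrDl ltr_wpDr // sumr_ge0.
Qed.

Lemma sub_le_of_shifted_le (R : realFieldType) (p q x y T : R) :
  `|p| <= T -> `|q| <= T -> p + x <= q + y -> x - y <= T + T.
Proof. by rewrite !ler_norml => /andP[? ?] /andP[? ?] ?; lra. Qed.

Theorem theorem3p4 (R : realType) (V : finType) (E : rel V) (I J : finType)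
  (s t : I -> V) (d : I -> R)
  (tau : pathset E s t -> (pathset E s t -> R) -> R)
  (g : pathset E s t -> J -> (pathset E s t -> R) -> R)
  (hd : forall i, 0 < d i)
  (htau : forall a, continuous_on_F d (tau a))
  (hg_nonneg : forall a j x, feasible_flow d x -> 0 <= g a j x)
  (hg_const : forall a j x y, feasible_flow d x -> feasible_flow d y ->
                g a j x = g a j y)
  (B : J -> R)
  (hB : feasible_budget d g B)
  (hext : extremal d g B)
  (hpar : pareto_minimal d g B) :
  strictly_implementable d tau g B.
Proof.
set P := pathset E s t in tau g htau hg_nonneg hg_const hB hext hpar *.
have [_ [x0 [fx0 Gx0]]] := hB.
pose tg : P -> I := fun a => tag a.
pose gam a j := g a j x0.
have gE a j x : feasible_flow d x -> g a j x = gam a j.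
  by move=> fx; apply: hg_const.
have GE j x : feasible_flow d x -> Gext g j x = \sum_a gam a j * x a.
  by move=> fx; apply: eq_bigr => a _; rewrite gE.
have budget x : feasible_flow d x ->
    feasible_budget d g (fun j => \sum_a gam a j * x a).
  move=> fx; split=> [j|]; last by exists x; split=> // j; rewrite GE.
  by apply: sumr_ge0 => a _; rewrite mulr_ge0 ?hg_nonneg ?fx.1.
have /choice[p0 p0P] := fun i => flow_support hd i (fx0 : flow tg d x0).
have tg_p0 i : tg (p0 i) = i by case: (p0P i).
(* The externality vector of the pure flow of [k]. *)
pose w (k : {ffun I -> P}) j := \sum_i d i * gam (sel tg p0 k i) j.
have mixE c j : \sum_k c k * w k j =
    \sum_a gam a j * (\sum_k c k * pure tg d p0 k a).
  by rewrite (mix_pure_sum d tg_p0).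
have mix_flow c : simplex c ->
    feasible_flow d (fun a => \sum_k c k * pure tg d p0 k a).
  by move=> sc; apply: (flow_mix sc) (pure_flow hd tg_p0).
have mix_budget c : simplex c -> feasible_budget d g (fun j => \sum_k c k * w k j).
  move=> sc; have := budget _ (mix_flow c sc); congr (feasible_budget d g _).
  by apply/funext => j; rewrite mixE.
have w_budget k : feasible_budget d g (w k).
  have := budget _ (pure_flow hd tg_p0 k); congr (feasible_budget d g _).
  by apply/funext => j; rewrite (pure_sum d tg_p0).
have [||lam [lam_gt0 expB]] := @exposed_vertex R _ J w B.
- by move=> c sc le j; apply: (hpar.2 _ (mix_budget c sc) le j).
- move=> k c mu sc mu01 BE j; apply: contrapT => ne; apply: hext.
  exists (w k), (fun j => \sum_l c l * w l j), mu; split=> //.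
  + exact: mix_budget.
  + by exists j.
have /choice[Mt MtP] := fun a => flow_bounded hd (htau a : cont_on (flow tg d) (tau a)).
have Mt0 a : 0 <= Mt a by apply: le_trans (MtP a x0 fx0).
pose T := \sum_a Mt a.
have tauT a x : feasible_flow d x -> `|tau a x| <= T.
  move=> fx; apply: le_trans (MtP a x fx) _.
  by rewrite /T (bigD1 a) //= lerDl sumr_ge0.
pose phi a := \sum_j lam j * gam a j.
(* Travel times lie within [T] of 0, so two of them differ by at most [T + T]; no saving of time
   outweighs a scaled price gap. *)
have [|M M0 MP] := @scale_beats_gaps R P phi (T + T).
  by rewrite addr_ge0 // sumr_ge0.
pose lam' j := M * lam j.
have costE a x : feasible_flow d x -> cost tau g lam' a x = tau a x + M * phi a.
  move=> fx; congr (_ + _); rewrite mulr_sumr; apply: eq_bigr => j _.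
  by rewrite gE // mulrA.
exists lam'; split=> [j|]; first by rewrite mulr_gt0.
split.
  have [|x [fx xeq]] := flow_equilibrium hd tg_p0
      (c := fun a x => tau a x + M * phi a).
    by move=> a; apply: cont_onD (htau a) (cont_on_cst _).
  exists x; split=> // a b tab xa.
  by rewrite !costE //; apply: xeq.
move=> u [fu ueq] j.
have umin a b : tg a = tg b -> 0 < u a -> phi a <= phi b.
  move=> tab ua; rewrite leNgt; apply/negP => /MP.
  have := ueq a b tab ua; rewrite !costE // => le.
  by rewrite ltNge mulrBr (sub_le_of_shifted_le (tauT a u fu) (tauT b u fu) le).
have [z sz zu] := flow_decomposition hd p0 (fu : flow tg d u).
have wu k : \sum_l z l * w l k = \sum_a gam a k * u a.
  by rewrite mixE; apply: eq_bigr => a _; rewrite zu.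
have phiG x : \sum_a phi a * x a = \sum_k lam k * \sum_a gam a k * x a.
  under eq_bigr do rewrite mulr_suml.
  rewrite exchange_big /=; apply: eq_bigr => k _; rewrite mulr_sumr.
  by apply: eq_bigr => a _; rewrite mulrA.
(* The left side is the [lam]-price of [u] minus that of [B]; [u] is no dearer than [x0], which
   respects [B]. *)
have le0 : \sum_l z l * (\sum_k lam k * (w l k - B k)) <= 0.
  have -> : \sum_l z l * (\sum_k lam k * (w l k - B k)) =
      \sum_k lam k * (\sum_a gam a k * u a - B k).
    under eq_bigr do rewrite mulr_sumr.
    rewrite exchange_big /=; apply: eq_bigr => k _; rewrite -wu.
    rewrite -[in RHS](mul1r (B k)) -sz.2 mulr_suml -sumrB mulr_sumr.
    by apply: eq_bigr => l _; rewrite -mulrBr mulrCA.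
  under eq_bigr do rewrite mulrBr.
  rewrite sumrB subr_le0 -phiG.
  apply: le_trans (flow_min_support hd fu (fx0 : flow tg d x0) umin) _.
  rewrite phiG; apply: ler_sum => k _.
  by rewrite ler_pM2l // -GE.
(* Nonnegative terms with sum at most 0 all vanish, so [z] lives on assignments with [w l = B], and
   [u] has externality vector exactly [B]. *)
have term_ge0 l : 0 <= z l * (\sum_k lam k * (w l k - B k)).
  rewrite mulr_ge0 ?sz.1 //; case: (expB l) => [wB|/ltW//].
  by rewrite big1 // => k _; rewrite wB subrr mulr0.
rewrite GE // -wu -[leRHS]mul1r -sz.2 mulr_suml le_eqVlt; apply/orP; left.
apply/eqP/eq_bigr => l _.
have [-> //|lt] := expB l.
have : z l * (\sum_k lam k * (w l k - B k)) == 0.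
  rewrite eq_le term_ge0 andbT; apply: le_trans le0.
  by rewrite [leRHS](bigD1 l) //= lerDl sumr_ge0.
by rewrite mulf_eq0 (gt_eqF lt) orbF => /eqP ->; rewrite !mul0r.
Qed.
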